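(* For every integer $m\ge1$, the Binet polynomial $b_m(\alpha)$, which has degree $m-1$ and leading coefficient $\frac1{12}$, has $m-1$ real, distinct zeros $\xi_1(m)>\xi_2(m)>\cdots>\xi_{m-1}(m)$, so that $$b_m(\alpha)=\frac1{12}\prod_{j=1}^{m-1}\left(\alpha-\xi_j(m)\right).$$
   Context: $S_m^{(k)}$ denotes the (signed) Stirling number of the first kind, defined by $\prod_{k=0}^{m-1}(x-k)=\sum_{k=0}^{m}S_m^{(k)}x^k$. For $m\ge1$ the Binet polynomial is $$b_m(\alpha)=\frac1m\sum_{k=1}^{m}\left\{\frac{\alpha^{k+2}-(\alpha-1)^{k+2}}{k+2}+\frac{\left(\frac12-\alpha\right)\left(\alpha^{k+1}-(\alpha-1)^{k+1}\right)}{k+1}\right\}(-1)^{k-m}S_m^{(k)},$$ equivalently $b_m(\alpha)=\frac1m\int_{\alpha-1}^{\alpha}\left(x+\frac12-\alpha\right)\prod_{k=0}^{m-1}(k+x)\,dx$. Empty products equal $1$. *)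

(* Defs.v *)
From mathcomp Require Import all_boot all_order all_algebra.
From mathcomp Require Import reals.

Set Implicit Arguments.
Unset Strict Implicit.
Unset Printing Implicit Defensive.

Import Order.TTheory GRing.Theory Num.Theory.
Local Open Scope ring_scope.

(* Signed Stirling number of the first kind S_m^(k): the coefficient of x^k
   in x (x - 1) ... (x - m + 1). *)
Definition stirling1 (m k : nat) : int :=
  (\prod_(0 <= j < m) ('X - (j%:R)%:P) : {poly int})`_k.

(* Binet polynomial b_m, with 'X standing for alpha; the hypothesis 0 < m is
   left to the uses of the definition.  The exponent k - m of the sign is an
   integer, since subtraction on nat would truncate it to 0. *)
Definition binet_poly (R : realType) (m : nat) : {poly R} :=
  m%:R^-1 *:
  \sum_(1 <= k < m.+1)
     ((-1) ^ (k%:Z - m%:Z) * (stirling1 m k)%:~R) *: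
     ((k + 2)%:R^-1 *: ('X^(k + 2) - ('X - 1) ^+ (k + 2)) +
      (k + 1)%:R^-1 *:
        (((2^-1)%:P - 'X) * ('X^(k + 1) - ('X - 1) ^+ (k + 1)))).

(* Main.v *)
Require Import Defs.
From mathcomp Require Import all_boot all_order all_algebra.
From mathcomp Require Import reals polyrcf ring lra zify.

Set Implicit Arguments.
Unset Strict Implicit.
Unset Printing Implicit Defensive.

Import Order.TTheory GRing.Theory Num.Theory.
Local Open Scope ring_scope.

(* Write Q(x) = x (x + 1) ... (x + m - 1) and c = alpha - 1/2.  Then m b_m(alpha)
   is the integral of u (Q(c + u) - Q(c - u)) over 0 < u < 1/2.  At an integer
   alpha = 1 - j with 2j <= m, Q(c + u) factors as an even function of u of sign
   (-1)^j times a product of increasing positive factors, so b_m(1 - j) has sign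
   (-1)^j, or vanishes when 2j = m; the reflection Q(1 - m - x) = (-1)^m Q(x)
   gives the signs for 2j > m.  The sign changes between consecutive integers,
   with the central zero when m is even, account for all m - 1 zeros. *)

(** * Rising factorials and Stirling numbers *)

Definition rising (R : nzRingType) (m : nat) : {poly R} :=
  \prod_(0 <= j < m) ('X + (j%:R)%:P).

Lemma size_rising (R : nzRingType) m : size (rising R m) = m.+1.
Proof.
rewrite /rising (eq_bigr (fun j => 'X - (- j%:R)%:P)); last first.
  by move=> j _; rewrite polyCN opprK.
by rewrite size_prod_XsubC size_iota subn0.
Qed.

Lemma coef_rising_top (R : nzRingType) m : (rising R m)`_m = 1.
Proof.
have -> : m = (size (rising R m)).-1 by rewrite size_rising.
rewrite size_rising /= -[X in _`_X]/(m.+1.-1) -(size_rising R m) -/(lead_coef _).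
rewrite /rising (eq_bigr (fun j => 'X - (- j%:R)%:P)); last first.
  by move=> j _; rewrite polyCN opprK.
by apply/monicP; exact: monic_prod_XsubC.
Qed.

Lemma coef0_rising (R : nzRingType) m : (0 < m)%N -> (rising R m)`_0 = 0.
Proof.
case: m => // m _.
by rewrite /rising big_nat_recl // polyC0 addr0 coefXM.
Qed.

(** Splitting off the last factor gives both sides the same recurrence, the sign absorbing the
    passage from [x] to [-x]. *)
Lemma coef_rising (R : nzRingType) m k :
  (rising R m)`_k = (-1) ^+ (m + k) * (stirling1 m k)%:~R.
Proof.
rewrite /rising /stirling1; elim: m k => [|m IH] k.
  rewrite !big_geq // !coef1; case: eqP => [->|_] //=; first by rewrite !expr0 mul1r.
  by rewrite mulr0.
rewrite !big_nat_recr //= mulrDr mulrBr coefD coefB !coefMX !coefMC !IH.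
rewrite rmorphB rmorphM /= mulrBr addSn exprS !mulN1r !mulNr opprK mulrA.
rewrite rmorph_nat; congr (_ + _).
case: k => [|k] /=; first by rewrite mulr0 oppr0.
by rewrite addnS exprS mulN1r mulNr opprK.
Qed.

Lemma horner_rising (R : comNzRingType) m (x : R) :
  (rising R m).[x] = \prod_(0 <= j < m) (x + j%:R).
Proof.
by rewrite /rising horner_prod; apply: eq_bigr => j _; rewrite !hornerE.
Qed.

(** * Degree and leading coefficient of the Binet polynomial *)

Lemma coef_Xsub1_exp (R : nzRingType) n i :
  (i <= n)%N -> (('X - 1 : {poly R}) ^+ n)`_i = (-1) ^+ (n - i) * 'C(n, i)%:R.
Proof.
elim: n i => [|n IH] i.
  by rewrite leqn0 => /eqP->; rewrite expr0 coef1 subn0 expr0 mul1r.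
rewrite exprSr mulrBr mulr1 coefB coefMX.
case: i => [_|i]; first by rewrite IH //= !subn0 !bin0 exprS !mulr1 mulN1r sub0r.
rewrite ltnS /= => hi; rewrite IH // subSS binS natrD mulrDr addrC; congr (_ + _).
move: hi; rewrite leq_eqVlt => /predU1P[->|hi].
  rewrite nth_default ?bin_small ?mulr0 ?oppr0 //.
  by rewrite -polyC1 size_exp_XsubC.
by rewrite IH // -mulNr -mulN1r -exprS -subSn.
Qed.

(** The integral of [(x + 1/2 - alpha) x^k] over [[alpha - 1, alpha]], with ['X] standing for
    alpha. *)
Definition binet_basis (R : realType) (k : nat) : {poly R} :=
  (k + 2)%:R^-1 *: ('X^(k + 2) - ('X - 1) ^+ (k + 2)) +
  (k + 1)%:R^-1 *:
    (((2^-1)%:P - 'X) * ('X^(k + 1) - ('X - 1) ^+ (k + 1))).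

Lemma binet_polyE (R : realType) m :
  binet_poly R m =
  m%:R^-1 *: \sum_(1 <= k < m.+1) (rising R m)`_k *: binet_basis R k.
Proof.
rewrite /binet_poly; congr (_ *: _); apply: eq_bigr => k _; congr (_ *: _).
rewrite coef_rising; congr (_ * _).
rewrite expfzDr ?oppr_eq0 ?oner_eq0 // -invr_expz -exprVn invrN1 addnC exprD.
by rewrite -exprnP.
Qed.

Lemma coef_diff_pow (R : nzRingType) d i :
  ('X^(i + d.+1) - ('X - 1) ^+ (i + d.+1) : {poly R})`_i =
  (-1) ^+ d * 'C(i + d.+1, d.+1)%:R.
Proof.
rewrite coefB coefXn coef_Xsub1_exp ?leq_addr // -{1}[i]addn0 eqn_add2l sub0r.
by rewrite addKn -bin_sub ?leq_addr // addKn exprS mulN1r mulNr opprK.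
Qed.

Lemma size_diff_pow (R : nzRingType) n :
  (size ('X^n - ('X - 1) ^+ n : {poly R})%R <= n)%N.
Proof.
apply/leq_sizeP => j; rewrite leq_eqVlt => /predU1P[<-|hj].
  by rewrite coefB coefXn eqxx coef_Xsub1_exp // subnn binn mulr1 subrr.
rewrite coefB coefXn (gtn_eqF hj) nth_default ?subr0 //.
by rewrite -polyC1 size_exp_XsubC.
Qed.

Lemma bin3E (R : numFieldType) n :
  'C(n.+2, 3)%:R = n.+2%:R * n.+1%:R * n%:R / 6 :> R.
Proof.
apply: (mulIf (_ : 6 != 0 :> R)); rewrite ?pnatr_eq0 // mulfVK ?pnatr_eq0 //.
rewrite -!natrM; congr _%:R.
have := bin_ffact n.+2 3; rewrite !ffactnS ffactn0 /= => ->.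
by rewrite muln1 mulnA.
Qed.

Lemma bin2E (R : numFieldType) n : 'C(n.+1, 2)%:R = n.+1%:R * n%:R / 2 :> R.
Proof.
apply: (mulIf (_ : 2 != 0 :> R)); rewrite ?pnatr_eq0 // mulfVK ?pnatr_eq0 //.
rewrite -!natrM; congr _%:R.
have := bin_ffact n.+1 2; rewrite !ffactnS ffactn0 /= => ->.
by rewrite muln1.
Qed.

Lemma coef_binet_basis (R : realType) k i :
  (binet_basis R k.+1)`_i.+1 =
  k.+3%:R^-1 * ('X^(k.+3) - ('X - 1) ^+ k.+3)`_i.+1 +
  k.+2%:R^-1 * (2^-1 * ('X^(k.+2) - ('X - 1) ^+ k.+2)`_i.+1
                - ('X^(k.+2) - ('X - 1) ^+ k.+2)`_i).
Proof.
by rewrite /binet_basis addn2 addn1 coefD !coefZ mulrBl (coefB (_%:P * _)) coefCM coefXM.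
Qed.

(** The weight has mean zero on the interval of integration, so integrating [x^(k.+1)] against it
    loses one degree in alpha. *)
Lemma size_binet_basis (R : realType) k : (size (binet_basis R k.+1) <= k.+1)%N.
Proof.
have h1 : k.+3%:R != 0 :> R by rewrite pnatr_eq0.
have h2 : k.+2%:R != 0 :> R by rewrite pnatr_eq0.
apply/leq_sizeP => -[//|j]; rewrite coef_binet_basis.
(* Only degrees [k.+1] and [k.+2] need a cancellation; above them the power differences have no
   coefficients. *)
rewrite ltnS leq_eqVlt => /predU1P[<-|].
  have := coef_diff_pow R 1 k.+1; have := coef_diff_pow R 0 k.+1.
  have := coef_diff_pow R 1 k.
  rewrite addn1 !addn2 !bin1 !bin2E => -> -> ->.
  by rewrite -!natr1 in h1 h2 *; field; rewrite h1 h2.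
rewrite leq_eqVlt => /predU1P[<-|hj].
  have := coef_diff_pow R 0 k.+2; have := coef_diff_pow R 0 k.+1.
  rewrite !addn1 !bin1 [X in 2^-1 * X]nth_default ?size_diff_pow // => -> ->.
  by rewrite -!natr1 in h1 h2 *; field; rewrite h1 h2.
rewrite !nth_default ?mulr0 ?subr0 ?mulr0 ?addr0 //.
all: by apply: leq_trans (size_diff_pow _ _) _; lia.
Qed.

(** The constant 1/12 is the second moment of [u] on [[-1/2, 1/2]]. *)
Lemma coef_binet_basis_top (R : realType) k :
  (binet_basis R k.+1)`_k = k.+1%:R / 12.
Proof.
case: k => [|k].
  rewrite /binet_basis addn2 addn1 coefD !coefZ mulrBl (coefB (_%:P * _)).
  rewrite coefCM coefXM /=.
  rewrite (coef_diff_pow R 2 0) (coef_diff_pow R 1 0) !add0n !binn.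
  by rewrite subr0 sqrrN expr1n; field.
have h1 : k.+4%:R != 0 :> R by rewrite pnatr_eq0.
have h2 : k.+3%:R != 0 :> R by rewrite pnatr_eq0.
rewrite coef_binet_basis.
have := coef_diff_pow R 2 k.+1; have := coef_diff_pow R 1 k.+1.
have := coef_diff_pow R 2 k.
rewrite !addn3 !addn2 !bin3E bin2E => -> -> ->.
by rewrite -!natr1 in h1 h2 *; field; rewrite h1 h2.
Qed.

Lemma size_binet_poly_le (R : realType) m : (size (binet_poly R m) <= m)%N.
Proof.
rewrite binet_polyE; apply: leq_trans (size_scale_leq _ _) _.
rewrite big_nat; apply: leq_trans (size_sum _ _ _) _.
apply/bigmax_leqP_seq => -[|k] _ //.
case/andP=> _ hk; apply: leq_trans (size_scale_leq _ _) _.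
exact: leq_trans (size_binet_basis _ _) _.
Qed.

Lemma coef_binet_poly_top (R : realType) m : (binet_poly R m.+1)`_m = 12^-1.
Proof.
rewrite binet_polyE coefZ coef_sum big_nat_recr //= coefZ coef_rising_top mul1r.
(* Only the last term of the sum reaches degree [m]. *)
rewrite big_nat big1 => [|[//|k] /andP[_ hk]]; last first.
  by rewrite coefZ [X in _ * X]nth_default ?mulr0 // (leq_trans (size_binet_basis _ _)).
by rewrite add0r coef_binet_basis_top mulrA mulVf ?mul1r // pnatr_eq0.
Qed.

Lemma size_binet_poly (R : realType) m : size (binet_poly R m.+1) = m.+1.
Proof.
apply/eqP; rewrite eqn_leq size_binet_poly_le ltnNge; apply/negP => /leq_sizeP h.
by have /eqP := h m (leqnn m); rewrite coef_binet_poly_top invr_eq0 pnatr_eq0.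
Qed.

Lemma lead_coef_binet_poly (R : realType) m :
  lead_coef (binet_poly R m.+1) = 12^-1.
Proof. by rewrite /lead_coef size_binet_poly coef_binet_poly_top. Qed.

(** * From the integral to a single value of the integrand *)

(* Substituting x = c + u turns the weight x + 1/2 - alpha into u; the integral
   over u is then the increment on [0, 1/2] of the primitive G below, so the mean
   value theorem replaces it by the integrand at a single point. *)
Lemma binet_poly_mvt (R : realType) m (a : R) : (0 < m)%N ->
  exists2 u : R, 0 < u < 2^-1 &
    m%:R * (binet_poly R m).[a] =
    u / 2 * ((rising R m).[a - 2^-1 + u] - (rising R m).[a - 2^-1 - u]).
Proof.
move=> m0; set Q := rising R m; set c := a - 2^-1.
(* A primitive of [(x - c) Q(x)]; starting at [k = 1] is harmless because [Q] has no constant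
   term. *)
pose F : {poly R} := \sum_(1 <= k < m.+1) Q`_k *:
  (k.+2%:R^-1 *: 'X^(k.+2) + (2^-1 - a) *: (k.+1%:R^-1 *: 'X^(k.+1))).
have dF : F^`() = ('X - c%:P) * Q.
  rewrite /F raddf_sum /= [in RHS](_ : Q = \sum_(1 <= k < m.+1) Q`_k *: 'X^k).
    rewrite mulr_sumr; apply: eq_bigr => k _.
    rewrite !(derivZ, derivD, derivXn) /= -!(scaler_nat _ 'X^_) !scalerA.
    rewrite mulVf ?pnatr_eq0 // -mulrA mulVf ?pnatr_eq0 // mulr1 scale1r.
    rewrite -scalerAr; congr (_ *: _).
    by rewrite exprS mulrBl mul_polyC -[in RHS]scaleNr opprB.
  rewrite -[LHS]coefK size_rising poly_def -(big_mkord xpredT (fun k => Q`_k *: 'X^k)).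
  by rewrite big_nat_recl // coef0_rising // scale0r add0r big_add1.
pose G := (F \Po ('X + c%:P)) - (F \Po (c%:P - 'X)).
(* [G(0) = 0] and [G(1/2) = F(a) - F(a - 1)]; the length of the interval supplies the factor 1/2. *)
have [u + eG] := @poly_mvt R 0 2^-1 G ltac:(lra).
rewrite in_itv /= => hu; exists u => //.
have bF : m%:R * (binet_poly R m).[a] = F.[a] - F.[a - 1].
  rewrite binet_polyE hornerZ mulrA divff ?pnatr_eq0 -?lt0n // mul1r.
  rewrite /F !horner_sum -sumrB; apply: eq_bigr => k _.
  rewrite /binet_basis addn2 addn1 -polyC1.
  rewrite !(hornerXn, horner_exp, hornerD, hornerN, hornerZ, hornerM, hornerC, hornerX).
  ring.
have dG : G^`().[u] = u * (Q.[c + u] - Q.[c - u]).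
  rewrite /G derivB !deriv_comp derivB derivD derivX !derivC dF.
  rewrite !(hornerD, hornerN, hornerM, horner_comp, hornerC, hornerX).
  by rewrite (addrC u); ring.
move: eG; rewrite dG /G !(hornerD, hornerN, horner_comp, hornerC, hornerX) bF.
rewrite add0r !subr0 subrr subr0 /c.
have -> : 2^-1 + (a - 2^-1) = a by ring.
have -> : a - 2^-1 - 2^-1 = a - 1 by field.
by move=> ->; ring.
Qed.

(** * Signs at the integers *)

(** The value of [rising R m] at [1/2 - j + u], which is [c + u] for [alpha = 1 - j]. *)
Definition half_rising (R : realType) m j (u : R) : R :=
  \prod_(0 <= k < m) (k%:R - j%:R + 2^-1 + u).

(** The zeros in [u] are the half-integers from [-(j - 1/2)] to [j - 1/2]; opposite ones pair up. *)
Lemma half_rising_even (R : realType) j (u : R) :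
  half_rising j.*2 j u = \prod_(0 <= i < j) (u ^+ 2 - (i%:R + 2^-1) ^+ 2).
Proof.
rewrite /half_rising; elim: j => [|j IH]; first by rewrite !big_geq.
rewrite doubleS big_nat_recl // big_nat_recr //= [in RHS]big_nat_recr //= -IH.
rewrite (eq_bigr (fun k => k%:R - j%:R + 2^-1 + u)) => [|k _]; last first.
  by rewrite -!natr1; ring.
by rewrite -!muln2 -!natr1 natrM; field.
Qed.

Lemma half_rising_split (R : realType) m j (u : R) : (j.*2 <= m)%N ->
  half_rising m j u = half_rising j.*2 j u *
    \prod_(0 <= i < m - j.*2) (i%:R + j%:R + 2^-1 + u).
Proof.
move=> hj; rewrite /half_rising (big_cat_nat (n := j.*2)) //=; congr (_ * _).
rewrite -{1}[j.*2]add0n big_addn; apply: eq_bigr => i _.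
by rewrite natrD -muln2 natrM; ring.
Qed.

(** Reversing the product, [k] to [m - 1 - k], turns each factor into the negative of one for
    [m - j] and [-u]. *)
Lemma half_rising_reflect (R : realType) m j (u : R) : (j <= m)%N ->
  half_rising m j u = (-1) ^+ m * half_rising m (m - j) (- u).
Proof.
move=> hj; rewrite /half_rising big_nat_rev /= add0n.
rewrite -[in (-1) ^+ m](subn0 m) -prodr_const_nat -big_split /=.
apply: eq_big_nat => k /andP[_ hk]; by rewrite !natrB // -natr1; field.
Qed.

Lemma half_rising_even_sign (R : realType) j (u : R) : 0 < u < 2^-1 ->
  0 < (-1) ^+ j * half_rising j.*2 j u.
Proof.
move=> /andP[u0 u1]; rewrite half_rising_even.
rewrite -[in (-1) ^+ j](subn0 j) -prodr_const_nat -big_split /=.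
apply: prodr_gt0 => i _; have : 0 <= i%:R :> R by rewrite ler0n.
by nra.
Qed.

(** The even product is a common factor; the remaining factors, at least one, are positive at [-u]
    and larger at [u]. *)
Lemma half_rising_diff_sign (R : realType) m j (u : R) :
  (j.*2 < m)%N -> 0 < u < 2^-1 ->
  0 < (-1) ^+ j * (half_rising m j u - half_rising m j (- u)).
Proof.
move=> hj hu; rewrite !(half_rising_split _ (ltnW hj)).
have -> : half_rising j.*2 j (- u) = half_rising j.*2 j u.
  by rewrite !half_rising_even; apply: eq_bigr => i _; rewrite sqrrN.
rewrite -mulrBr mulrA mulr_gt0 ?half_rising_even_sign // subr_gt0.
case/andP: hu => u0 u1.
apply: ltr_prod_nat => [|i _]; first by rewrite subn_gt0.
have : 0 <= i%:R :> R by rewrite ler0n.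
have : 0 <= j%:R :> R by rewrite ler0n.
move=> ? ?; apply/andP; split; lra.
Qed.

Lemma half_rising_diff_sym (R : realType) m j (u : R) : (j <= m)%N ->
  half_rising m j u - half_rising m j (- u) =
  (-1) ^+ m.+1 *
    (half_rising m (m - j) u - half_rising m (m - j) (- u)).
Proof.
move=> hj; rewrite !(half_rising_reflect _ hj) opprK exprS; ring.
Qed.

Lemma binet_poly_at (R : realType) m j : (0 < m)%N ->
  exists2 u : R, 0 < u < 2^-1 &
    m%:R * (binet_poly R m).[1 - j%:R] =
    u / 2 * (half_rising m j u - half_rising m j (- u)).
Proof.
move=> m0; have [u hu e] := binet_poly_mvt (1 - j%:R : R) m0.
exists u => //; rewrite e !horner_rising /half_rising.
by congr (_ * (_ - _)); apply: eq_bigr => k _; field.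
Qed.

Lemma binet_poly_sign_lt (R : realType) m j : (j.*2 < m)%N ->
  0 < (-1) ^+ j * (binet_poly R m).[1 - j%:R].
Proof.
move=> hj; have m0 : (0 < m)%N by lia.
have [u hu e] := binet_poly_at R j m0.
have mR : 0 < m%:R :> R by rewrite ltr0n.
rewrite -(pmulr_rgt0 _ mR) mulrCA e mulrCA pmulr_rgt0 ?half_rising_diff_sign //.
by rewrite divr_gt0 //; case/andP: hu.
Qed.

Lemma binet_poly_sign_gt (R : realType) m j : (j <= m < j.*2)%N ->
  0 < (-1) ^+ j.+1 * (binet_poly R m).[1 - j%:R].
Proof.
move=> /andP[hjm hj]; have m0 : (0 < m)%N by lia.
have [u hu e] := binet_poly_at R j m0.
have mR : 0 < m%:R :> R by rewrite ltr0n.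
rewrite -(pmulr_rgt0 _ mR) mulrCA e mulrCA pmulr_rgt0; last first.
  by rewrite divr_gt0 //; case/andP: hu.
rewrite half_rising_diff_sym // mulrA -exprD addSnnS.
(* The exponents have equal parity, and [m - j] lies in the range already treated, as
   [2 (m - j) < m]. *)
have -> : (-1) ^+ (j + m.+2) = (-1) ^+ (m - j) :> R.
  by rewrite -signr_odd -[in RHS]signr_odd; congr (_ ^+ _); lia.
by apply: half_rising_diff_sign => //; lia.
Qed.

Lemma binet_poly_root_mid (R : realType) m j : (0 < m)%N -> m = j.*2 ->
  root (binet_poly R m) (1 - j%:R).
Proof.
move=> m0 mj; have [u hu e] := binet_poly_at R j m0.
move: e; rewrite [in RHS]mj !half_rising_even.
under [X in _ * (_ - X)]eq_bigr do rewrite sqrrN.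
by move/eqP; rewrite subrr mulr0 mulf_eq0 pnatr_eq0 (gtn_eqF m0).
Qed.

(** * Location of the zeros and factorisation *)

Lemma sign_change_root (R : realType) (p : {poly R}) n j :
  0 < (-1) ^+ n * p.[1 - j%:R] -> 0 < (-1) ^+ n.+1 * p.[1 - j.+1%:R] ->
  exists2 x, - j%:R < x < 1 - j%:R & root p x.
Proof.
have -> : 1 - j.+1%:R = - j%:R :> R by rewrite -natr1; ring.
move=> h1 h2; have [|x] := @poly_ivtoo R p (- j%:R) (1 - j%:R) ltac:(lra).
  rewrite -oppr_gt0; have := mulr_gt0 h2 h1.
  by rewrite exprS mulN1r !mulNr mulrACA -expr2 sqrr_sign mul1r.
by rewrite in_itv /= => hx rx; exists x.
Qed.

(* The zeros to the right of the centre 1 - m/2 are bracketed by consecutive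
   integers, and so are those to its left, with indices shifted by one; the
   centre itself is a zero when m is even. *)
Lemma binet_poly_root (R : realType) m i : (i.+1 < m)%N ->
  exists x : R, root (binet_poly R m) x /\ [\/ (i.+1.*2 < m)%N /\ - i%:R < x < 1 - i%:R,
        (i.+1.*2 = m)%N /\ x = - i%:R
      | (m < i.+1.*2)%N /\ - i.+1%:R < x < - i%:R].
Proof.
move=> him; have iE : 1 - i.+1%:R = - i%:R :> R by rewrite -natr1; ring.
case: (ltngtP i.+1.*2 m) => [hi|hi|hi].
- have [||x hx rx] := @sign_change_root R (binet_poly R m) i i.
  + by apply: binet_poly_sign_lt; lia.
  + exact: binet_poly_sign_lt.
  by exists x; split=> //; constructor 1.
(* Left of the centre the sign at [1 - j] is [(-1) ^+ j.+1], hence the exponent [i.+2] for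
   [j = i.+1]. *)
- have [||x hx rx] := @sign_change_root R (binet_poly R m) i.+2 i.+1.
  + by apply: binet_poly_sign_gt; lia.
  + by apply: binet_poly_sign_gt; lia.
  by exists x; split=> //; constructor 3; rewrite -iE.
- exists (- i%:R); split; last by constructor 2.
  by rewrite -iE; apply: binet_poly_root_mid => //; lia.
Qed.

Theorem mainTheorem8 (R : realType) (m : nat) (hm : (1 <= m)%N) :
  [/\ size (binet_poly R m) = (m - 1).+1,
      lead_coef (binet_poly R m) = 12^-1 &
      exists xi : 'I_(m - 1) -> R,
        [/\ forall i j : 'I_(m - 1), (i < j)%N -> xi j < xi i,
            forall j : 'I_(m - 1), root (binet_poly R m) (xi j) &
            binet_poly R m = 12^-1 *: \prod_(j < m - 1) ('X - (xi j)%:P)]].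
Proof.
case: m hm => // m _; rewrite subn1 /=.
split; [exact: size_binet_poly | exact: lead_coef_binet_poly |].
have [xi hxi] :=
  fin_all_exists (fun i : 'I_m => @binet_poly_root R m.+1 i (ltn_ord i)).
have xi_root j : root (binet_poly R m.+1) (xi j) by case: (hxi j).
have xi_dec (i j : 'I_m) : (i < j)%N -> xi j < xi i.
  move=> ij; have ijR : i.+1%:R <= j%:R :> R by rewrite ler_nat.
  (* Impossible positions relative to the centre fall to [lia]; in the others [i + 1 <= j] separates
     the two zeros. *)
  move: (hxi i) (hxi j) ijR; rewrite -!natr1.
  by move=> [_ [] [hi xE]] [_ [] [hj yE]] ijR; try lia; lra.
exists xi; split => //.
(* [m] distinct roots exhaust a polynomial of size [m.+1]; distinctness comes from [xi_dec]. *)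
have := @all_roots_prod_XsubC R (binet_poly R m.+1) [seq xi j | j <- enum 'I_m].
rewrite size_map size_enum_ord size_binet_poly lead_coef_binet_poly.
rewrite big_map big_enum /=; apply => //.
- by apply/allP => _ /mapP[j _ ->].
- rewrite uniq_rootsE map_inj_uniq ?enum_uniq // => i j eij; apply/val_inj.
  by case: (ltngtP i j) => // /xi_dec; rewrite eij ltxx.
Qed.
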